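(* Let $(G,P)$ be a quasi-lattice ordered group. Consider a Nica-covariant representation $V:P\to B(\mathcal{H})$. Then $V$ is tight if and only if for every $F\in\mathcal{F}$ one has $\prod_{t\in F}(1-V(t)V(t)^{*})=0$.
   Context: **Quasi-lattice ordered groups.** Let $G$ be a discrete group and $P$ a subsemigroup of $G$ containing the identity $e$ with $P\cap P^{-1}=\{e\}$. Define the left-invariant partial order on $G$ by $x\le y$ iff $x^{-1}y\in P$. The pair $(G,P)$ is quasi-lattice ordered if (1) any $x\in PP^{-1}$ has a least upper bound in $P$, and (2) if $s,t\in P$ have a common upper bound in $P$ then they have a least common upper bound (in $P$), denoted $\sigma(s,t)$. **Nica's inverse semigroup.** Let $W:P\to B(\ell^{2}(P))$, $W(p)\delta_{a}=\delta_{pa}$, where $\{\delta_{a}\}$ is the canonical orthonormal basis. The set $\mathcal{N}:=\{W(s)W(t)^{*}:s,t\in P\}\cup\{0\}$ is an inverse semigroup of partial isometries, with set of projections $E=\{W(t)W(t)^{*}:t\in P\}\cup\{0\}$. **Nica-covariance.** An isometric representation $V:P\to B(\mathcal{H})$ on a Hilbert space $\mathcal{H}$ (i.e. $V(t)^{*}V(t)=1$, $V(e)=1$, $V(s)V(t)=V(st)$ for $s,t\in P$) is Nica-covariant if, with $L(t):=V(t)V(t)^{*}$, one has $L(s)L(t)=L(\sigma(s,t))$ if $s,t$ have a common upper bound in $P$, and $L(s)L(t)=0$ otherwise. A Nica-covariant representation is the same thing as a unital representation of $\mathcal{N}$ sending $0$ to $0$, via $W(s)W(t)^{*}\mapsto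 V(s)V(t)^{*}$. **Tightness.** For a semilattice $E$ of commuting projections containing $0,1$ and $Z\subset E$, a subset $F\subset Z$ is a cover for $Z$ if for every non-zero $z\in Z$ there is $f\in F$ with $fz\neq0$; it is a finite cover if $F$ is finite. A representation $\sigma:E\to\mathcal{B}$ in a Boolean algebra $\mathcal{B}$ is tight if for every $x\in E$ and every finite cover $Z$ of $[0,x]:=\{z\in E:z\le x\}$ one has $\sup_{z\in Z}\sigma(z)=\sigma(x)$. A unital representation $\sigma$ of an inverse semigroup $S$ containing $0,1$, with set of projections $E$, as partial isometries in a unital $C^*$-algebra is tight if $\sigma|_{E}$ is tight as a representation into the Boolean algebra of projections of the commutative $C^*$-algebra generated by $\sigma(E)$. A Nica-covariant representation is called tight if the corresponding representation of $\mathcal{N}$ is tight. **The family $\mathcal{F}$.** A finite subset $F\subset P$ covers $P$ if for every $x\in P$ there exists $y\in F$ such that $x$ and $y$ have a common upper bound in $P$. $\mathcal{F}:=\{F\subset P: F \text{ is finite and covers } P\}$. *)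

(* Defs.v *)
From HB Require Import structures.
From mathcomp Require Import all_boot all_order all_algebra finmap ring lra.
From mathcomp Require Import complex.
From mathcomp Require Import boolp classical_sets functions cardinality fsbigop.
From mathcomp Require Import reals ereal topology normedtype esum numfun.

Set Implicit Arguments.
Unset Strict Implicit.
Unset Printing Implicit Defensive.
Import Order.TTheory GRing.Theory Num.Theory.
Import numFieldNormedType.Exports.
Local Open Scope classical_set_scope.
Local Open Scope ring_scope.

(* The inner product is linear in its first argument. *)
HB.mixin Record isHilbert (R : realType) H & CompleteNormedModule R[i] H := {
  hdot : {dot H for Num.conj} ;
  hdot_norm : forall x : H, hdot x x = `|x| ^+ 2 }.

#[short(type="hilbertType")]
HB.structure Definition Hilbert (R : realType) :=
  {H of CompleteNormedModule R[i] H & isHilbert R H}.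

(* B(H), with composition as the product; a linear map is bounded if and only if
   it is continuous. *)
Record bop (R : realType) (H : normedModType R[i]) := Bop {
  bop_fun :> H -> H;
  bop_linear : linear bop_fun;
  bop_continuous : continuous bop_fun }.

Section bop.
Context {R : realType} {H : normedModType R[i]}.
Implicit Types S T U : bop H.

Lemma bopP S T : (forall x, S x = T x) <-> S = T.
Proof.
split=> [|-> //]; case: S T => [f lf cf] [g lg cg] /= /funext fg.
by subst g; rewrite (Prop_irrelevance lf lg) (Prop_irrelevance cf cg).
Qed.

HB.instance Definition _ (T : bop H) :=
  GRing.isLinear.Build R[i] H H *:%R T (bop_linear T).
HB.instance Definition _ := gen_eqMixin (bop H).
HB.instance Definition _ := gen_choiceMixin (bop H).

Fact bop0_subproof :
  linear (fun _ : H => 0 : H) /\ continuous (fun _ : H => 0 : H).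
Proof. by split=> [a x y|x]; [rewrite scaler0 addr0|exact: cvg_cst]. Qed.

Fact bop1_subproof : linear (@id H) /\ continuous (@id H).
Proof. by split=> // x; exact: cvg_id. Qed.

Fact bopN_subproof S : linear (fun x => - S x) /\ continuous (fun x => - S x).
Proof.
split=> [a x y|x]; first by rewrite linearP opprD scalerN.
by apply: cvgN; exact: bop_continuous.
Qed.

Fact bopD_subproof S T :
  linear (fun x => S x + T x) /\ continuous (fun x => S x + T x).
Proof.
split=> [a x y|x]; first by rewrite !linearP scalerDr addrACA.
by apply: cvgD; exact: bop_continuous.
Qed.

Fact bopZ_subproof (c : R[i]) S :
  linear (fun x => c *: S x) /\ continuous (fun x => c *: S x).
Proof.
split=> [a x y|x]; first by rewrite linearP scalerDr !scalerA mulrC.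
by apply: cvgZl_tmp; exact: bop_continuous.
Qed.

Fact bopM_subproof S T :
  linear (fun x => S (T x)) /\ continuous (fun x => S (T x)).
Proof.
split=> [a x y|x]; first by rewrite !linearP.
by apply: (@continuous_comp _ _ _ T S); exact: bop_continuous.
Qed.

Definition mk_bop f (h : linear f /\ continuous f) : bop H := Bop h.1 h.2.
Definition bop_zero := mk_bop bop0_subproof.
Definition bop_one := mk_bop bop1_subproof.
Definition bop_opp S := mk_bop (bopN_subproof S).
Definition bop_add S T := mk_bop (bopD_subproof S T).
Definition bop_scale c S := mk_bop (bopZ_subproof c S).
Definition bop_mul S T := mk_bop (bopM_subproof S T).

Fact bop_addA : associative bop_add.
Proof. by move=> S T U; apply/bopP => x /=; rewrite addrA. Qed.

Fact bop_addC : commutative bop_add.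
Proof. by move=> S T; apply/bopP => x /=; rewrite addrC. Qed.

Fact bop_add0 : left_id bop_zero bop_add.
Proof. by move=> S; apply/bopP => x /=; rewrite add0r. Qed.

Fact bop_addN : left_inverse bop_zero bop_opp bop_add.
Proof. by move=> S; apply/bopP => x /=; rewrite addNr. Qed.
HB.instance Definition _ := GRing.isZmodule.Build (bop H)
  bop_addA bop_addC bop_add0 bop_addN.

Fact bop_mulA : associative bop_mul.
Proof. by move=> S T U; apply/bopP. Qed.

Fact bop_mul1l : left_id bop_one bop_mul.
Proof. by move=> S; apply/bopP. Qed.

Fact bop_mul1r : right_id bop_one bop_mul.
Proof. by move=> S; apply/bopP. Qed.

Fact bop_mulDl : left_distributive bop_mul +%R.
Proof. by move=> S T U; apply/bopP. Qed.

Fact bop_mulDr : right_distributive bop_mul +%R.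
Proof. by move=> S T U; apply/bopP => x /=; rewrite linearD. Qed.
HB.instance Definition _ := GRing.Zmodule_isPzRing.Build (bop H)
  bop_mulA bop_mul1l bop_mul1r bop_mulDl bop_mulDr.

Fact bop_scaleA (a b : R[i]) S : bop_scale a (bop_scale b S) = bop_scale (a * b) S.
Proof. by apply/bopP => x /=; rewrite scalerA. Qed.

Fact bop_scale1 : left_id 1 bop_scale.
Proof. by move=> S; apply/bopP => x /=; rewrite scale1r. Qed.

Fact bop_scaleDr : right_distributive bop_scale +%R.
Proof. by move=> a S T; apply/bopP => x /=; rewrite scalerDr. Qed.

Fact bop_scaleDl S : {morph (bop_scale^~ S) : a b / a + b}.
Proof. by move=> a b; apply/bopP => x /=; rewrite scalerDl. Qed.
HB.instance Definition _ := GRing.Zmodule_isLmodule.Build R[i] (bop H)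
  bop_scaleA bop_scale1 bop_scaleDr bop_scaleDl.
End bop.

Section unordered_sums.
Context {R : realType} {I : choiceType}.
Implicit Types f g h : I -> R.

Definition abs_summable h := summable [set: I] (EFin \o h).

(* Sum of an absolutely summable family over an arbitrary index set. *)
Definition rsum h : R :=
  fine (\esum_(i in [set: I]) (EFin \o h)^\+ i
        - \esum_(i in [set: I]) (EFin \o h)^\- i)%E.

Definition csum (f : I -> R[i]) : R[i] :=
  Complex (rsum (fun i => complex.Re (f i))) (rsum (fun i => complex.Im (f i))).

Lemma abs_summable_le f g : (forall i, `|f i| <= g i) ->
  abs_summable g -> abs_summable f.
Proof.
move=> fg; apply: le_lt_trans; apply: le_esum => i _ /=.
rewrite lee_fin ler_normr; apply/orP; left; exact: fg.
Qed.

Lemma abs_summableD f g : abs_summable f -> abs_summable g ->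
  abs_summable (f \+ g).
Proof. by move=> /summableD h /h. Qed.

Lemma abs_summableN f : abs_summable f -> abs_summable (\- f).
Proof.
by rewrite /abs_summable => h; rewrite -[EFin \o _]/(\- (EFin \o f))%E -summableN.
Qed.

Lemma esumZ (c : R) (f : I -> \bar R) : 0 <= c -> (forall i, (0 <= f i)%E) ->
  (\esum_(i in [set: I]) (c%:E * f i) = c%:E * \esum_(i in [set: I]) f i)%E.
Proof.
rewrite le_eqVlt => /orP[/eqP<-|c0] f0.
  by rewrite mul0e esum1// => i _; rewrite mul0e.
have le (d : R) (g : I -> \bar R) : 0 < d -> (forall i, (0 <= g i)%E) ->
  (\esum_(i in [set: I]) (d%:E * g i) <= d%:E * \esum_(i in [set: I]) g i)%E.
  move=> d0 g0; apply: ge_ereal_sup => _ [X [finX _] <-].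
  rewrite -ge0_mule_fsumr; last by move=> i; exact: g0.
  apply: lee_wpmul2l; first by rewrite lee_fin ltW.
  by apply: ereal_sup_ubound; exists X => //; split.
apply/eqP; rewrite eq_le le//=.
have ic0 : 0 < c^-1 by rewrite invr_gt0.
have cf0 i : (0 <= c%:E * f i)%E by apply: mule_ge0 (f0 i); rewrite lee_fin ltW.
have h := le c^-1 (fun i => c%:E * f i)%E ic0 cf0.
have {}h : (\esum_(i in [set: I]) f i <=
    (c^-1)%:E * \esum_(i in [set: I]) (c%:E * f i))%E.
  apply: le_trans h; apply: le_esum => i _.
  by rewrite muleA -EFinM mulVf ?gt_eqF// mul1e.
have c0' : (0 <= c%:E)%E by rewrite lee_fin ltW.
have := lee_wpmul2l c0' h.
by rewrite muleA -EFinM mulfV ?gt_eqF// mul1e.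
Qed.

Lemma abs_summableZ (c : R) f : abs_summable f -> abs_summable (fun i => c * f i).
Proof.
rewrite /abs_summable /summable => sf.
under eq_esum do rewrite /= normrM EFinM.
by rewrite esumZ// lte_mul_pinfty.
Qed.

Lemma rsum_ge0E f : (forall i, 0 <= f i) ->
  rsum f = fine (\esum_(i in [set: I]) (f i)%:E)%E.
Proof.
move=> f0; rewrite /rsum; congr fine.
rewrite [X in (_ - X)%E](_ : _ = 0)%E ?sube0; last first.
  rewrite esum1// => i _; rewrite funenegE/=; apply/max_idPr.
  by rewrite lee_fin oppr_le0.
apply: eq_esum => i _; rewrite funeposE/=; apply/max_idPl.
by rewrite lee_fin.
Qed.

Lemma abs_summable_fin f : (forall i, 0 <= f i) -> abs_summable f ->
  (\esum_(i in [set: I]) (f i)%:E)%E \is a fin_num.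
Proof.
move=> f0; rewrite /abs_summable summableE (_ : esum _ _ = esum setT (EFin \o f))//.
by apply: eq_esum => i _ /=; rewrite ger0_norm.
Qed.

Lemma rsumB_ge0 f g : (forall i, 0 <= f i) -> (forall i, 0 <= g i) ->
  abs_summable f -> abs_summable g -> rsum (f \- g) = rsum f - rsum g.
Proof.
move=> f0 g0 sf sg; rewrite (rsum_ge0E f0) (rsum_ge0E g0) /rsum.
have F0 i : [set: I] i -> (0 <= (EFin \o f) i)%E by move=> _; rewrite /= lee_fin.
have G0 i : [set: I] i -> (0 <= (EFin \o g) i)%E by move=> _; rewrite /= lee_fin.
transitivity (fine (\esum_(i in [set: I]) (f i)%:E -
   \esum_(i in [set: I]) (g i)%:E)%E).
  by congr fine; exact: (esumB sf sg F0 G0).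
rewrite fineB//; by [exact: (abs_summable_fin f0 sf)|exact: (abs_summable_fin g0 sg)].
Qed.

Lemma rsumD_ge0 f g : (forall i, 0 <= f i) -> (forall i, 0 <= g i) ->
  abs_summable f -> abs_summable g -> rsum (f \+ g) = rsum f + rsum g.
Proof.
move=> f0 g0 sf sg; rewrite !rsum_ge0E//; last by move=> i; exact: addr_ge0.
under eq_esum do rewrite EFinD.
rewrite esumD// ?fineD//; first exact: abs_summable_fin.
- exact: abs_summable_fin.
- by move=> i _; rewrite lee_fin.
- by move=> i _; rewrite lee_fin.
Qed.

Let pos f i := Num.max (f i) 0.
Let neg f i := Num.max (- f i) 0.
Let pos_ge0 f i : 0 <= pos f i. Proof. by rewrite /pos le_max lexx orbT. Qed.
Let neg_ge0 f i : 0 <= neg f i. Proof. by rewrite /neg le_max lexx orbT. Qed.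
Let posneg f : f = pos f \- neg f.
Proof.
apply/funext => i; rewrite /= /pos /neg.
by case: (ltP 0 (f i)) => h; case: (ltP 0 (- f i)) => h'; lra.
Qed.
Let pos_le f i : `|pos f i| <= `|f i|.
Proof. by rewrite ger0_norm// /pos ge_max ler_norm normr_ge0. Qed.
Let neg_le f i : `|neg f i| <= `|f i|.
Proof. by rewrite ger0_norm// /neg ge_max -normrN ler_norm normr_ge0. Qed.
Let abs_sum f : abs_summable f -> abs_summable (fun i => `|f i|).
Proof.
move=> sf; rewrite /abs_summable /summable.
by under eq_esum do rewrite /= normr_id.
Qed.
Let pos_sum f : abs_summable f -> abs_summable (pos f).
Proof. by move=> /abs_sum; apply: abs_summable_le; exact: pos_le. Qed.
Let neg_sum f : abs_summable f -> abs_summable (neg f).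
Proof. by move=> /abs_sum; apply: abs_summable_le; exact: neg_le. Qed.

Let rsum_posneg f : abs_summable f -> rsum f = rsum (pos f) - rsum (neg f).
Proof.
move=> sf; rewrite {1}(posneg f) (rsumB_ge0 (@pos_ge0 f) (@neg_ge0 f))//.
  exact: pos_sum.
exact: neg_sum.
Qed.

Lemma rsumD f g : abs_summable f -> abs_summable g ->
  rsum (f \+ g) = rsum f + rsum g.
Proof.
move=> sf sg.
have pf := pos_sum sf; have pg := pos_sum sg.
have nf := neg_sum sf; have ng := neg_sum sg.
have p0 i : 0 <= (pos f \+ pos g) i by rewrite addr_ge0.
have n0 i : 0 <= (neg f \+ neg g) i by rewrite addr_ge0.
have -> : f \+ g = (pos f \+ pos g) \- (neg f \+ neg g).
  apply/funext => i /=; rewrite {1}(posneg f) {1}(posneg g) /=; ring.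
rewrite (rsumB_ge0 p0 n0 (abs_summableD pf pg) (abs_summableD nf ng)).
rewrite (rsumD_ge0 (@pos_ge0 f) (@pos_ge0 g) pf pg).
rewrite (rsumD_ge0 (@neg_ge0 f) (@neg_ge0 g) nf ng).
by rewrite (rsum_posneg sf) (rsum_posneg sg); ring.
Qed.

Lemma rsumN f : abs_summable f -> rsum (\- f) = - rsum f.
Proof.
move=> sf; have -> : \- f = neg f \- pos f.
  by apply/funext => i /=; rewrite {1}(posneg f) /=; ring.
rewrite (rsumB_ge0 (@neg_ge0 f) (@pos_ge0 f) (neg_sum sf) (pos_sum sf)).
by rewrite (rsum_posneg sf); ring.
Qed.

Let rsumZ_ge0 (c : R) f : 0 <= c -> (forall i, 0 <= f i) -> abs_summable f ->
  rsum (fun i => c * f i) = c * rsum f.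
Proof.
move=> c0 f0 sf; rewrite (rsum_ge0E f0) rsum_ge0E; last first.
  by move=> i; exact: mulr_ge0.
under eq_esum do rewrite EFinM.
by rewrite esumZ//  fineM//; exact: (abs_summable_fin f0 sf).
Qed.

Lemma rsumZ (c : R) f : abs_summable f -> rsum (fun i => c * f i) = c * rsum f.
Proof.
have ge (d : R) g : 0 <= d -> abs_summable g ->
    rsum (fun i => d * g i) = d * rsum g.
  move=> d0 sg; have pg := pos_sum sg; have ng := neg_sum sg.
  have -> : (fun i => d * g i) = (fun i => d * pos g i) \- (fun i => d * neg g i).
    by apply/funext => i /=; rewrite {1}(posneg g) /=; ring.
  have p0 i : 0 <= d * pos g i by rewrite mulr_ge0.
  have n0 i : 0 <= d * neg g i by rewrite mulr_ge0.
  rewrite (rsumB_ge0 p0 n0 (abs_summableZ d pg) (abs_summableZ d ng)).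
  rewrite (rsumZ_ge0 d0 (@pos_ge0 g) pg) (rsumZ_ge0 d0 (@neg_ge0 g) ng).
  by rewrite (rsum_posneg sg); ring.
move=> sf; have [c0|c0] := leP 0 c; first exact: ge.
have -> : (fun i => c * f i) = (\- (fun i => (- c) * f i)).
  by apply/funext => i /=; ring.
rewrite (rsumN (abs_summableZ (- c) sf)) ge//; first ring.
by rewrite oppr_ge0 ltW.
Qed.

Lemma rsum_ge0 f : (forall i, 0 <= f i) -> 0 <= rsum f.
Proof.
by move=> f0; rewrite rsum_ge0E//; apply/fine_ge0/esum_ge0 => i _; rewrite lee_fin.
Qed.

Lemma rsum_ge_term f i : (forall i, 0 <= f i) -> abs_summable f -> f i <= rsum f.
Proof.
move=> f0 sf; rewrite rsum_ge0E// -lee_fin fineK; last exact: abs_summable_fin.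
have fi0 j : (0 <= (f j)%:E)%E by rewrite lee_fin.
rewrite (esumID [set i])// setTI -[leLHS]adde0 leeD//.
  by rewrite esum_set1.
exact: esum_ge0.
Qed.

End unordered_sums.

Section dot_norm.
Context {C : numClosedFieldType} {U : lmodType C} (form : {dot U for Num.conj}).

Lemma dot_CauchySchwarz u v : `|form u v| ^+ 2 <= form u u * form v v.
Proof.
have [->|v0] := eqVneq v 0; first by rewrite !linear0r normr0 expr0n mulr0.
have vv0 : 0 < form v v by rewrite neq0_dnorm_gt0.
have := dnorm_ge0 form (form v v *: u - form u v *: v).
rewrite dnormB !dnormZ linearZl_LR linearZr_LR /=.
rewrite (mulrC (Num.conj (form u v))) -normCK (ger0_norm (ltW vv0)).
rewrite [Num.conj (form v v * _)]conj_Creal; last first.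
  by rewrite rpredM ?rpredX ?normr_real// ger0_real// ltW.
rewrite (_ : _ - _ = form v v * (form u u * form v v - `|form u v| ^+ 2)).
  by rewrite pmulr_rge0// subr_ge0.
by ring.
Qed.

Lemma dot_triangle (N : U -> C) : (forall u, 0 <= N u) ->
  (forall u, form u u = N u ^+ 2) -> forall u v, N (u + v) <= N u + N v.
Proof.
move=> N0 NE u v.
rewrite -ler_sqr ?nnegrE ?addr_ge0// -NE dnormD /= !NE sqrrD.
rewrite addrAC lerD2r lerD2l.
have -> : form u v + (form u v)^* = 'Re (form u v) *+ 2.
  by rewrite ReE mulr2n; field.
rewrite lerMn2r/=.
apply: le_trans (_ : `|form u v| <= _).
  apply: le_trans (leif_normC_Re_Creal _).1.
  by apply: real_ler_norm; exact: Creal_Re.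
rewrite -ler_sqr ?nnegrE ?mulr_ge0// exprMn -!NE.
exact: dot_CauchySchwarz.
Qed.

End dot_norm.

(* |z|^2 as an element of R *)
Definition sqmod {R : realType} (z : R[i]) : R :=
  complex.Re z ^+ 2 + complex.Im z ^+ 2.

Section csum.
Context {R : realType} {I : choiceType}.
Implicit Types u v : I -> R[i].

Definition csummable u := abs_summable (fun i => complex.Re (u i)) /\
  abs_summable (fun i => complex.Im (u i)).

Lemma csum_linear (a : R[i]) u v : csummable u -> csummable v ->
  csum (fun i => a * u i + v i) = a * csum u + csum v.
Proof.
case: a => a b [ru iu] [rv iv].
have sa := abs_summableZ a ru; have sb := abs_summableN (abs_summableZ b iu).
have ta := abs_summableZ a iu; have tb := abs_summableZ b ru.
rewrite /csum; simpc; congr Complex.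
- rewrite -(rsumZ a ru) -(rsumZ b iu) -(rsumN (abs_summableZ b iu)).
  rewrite -(rsumD sa sb) -(rsumD (abs_summableD sa sb) rv); congr rsum.
  by apply/funext => i /=; case: (u i) => x y; case: (v i).
- rewrite -(rsumZ a iu) -(rsumZ b ru).
  rewrite -(rsumD ta tb) -(rsumD (abs_summableD ta tb) iv); congr rsum.
  by apply/funext => i /=; case: (u i) => x y; case: (v i).
Qed.

Lemma csum_conj u : csummable u ->
  csum (fun i => Num.conj (u i)) = Num.conj (csum u).
Proof.
move=> [ru iu]; rewrite /csum -[RHS]/(Complex _ (- _)) -(rsumN iu).
by congr Complex; congr rsum; apply/funext => i /=; case: (u i).
Qed.

End csum.

Section ell2_def.
Context {R : realType} {I : choiceType}.
Implicit Types f g : I -> R[i].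

Definition square_summable f :=
  (\esum_(i in [set: I]) (sqmod (f i))%:E < +oo)%E.

Lemma sqmod_ge0 (z : R[i]) : 0 <= sqmod z.
Proof. by rewrite addr_ge0 ?sqr_ge0. Qed.

Lemma square_summableP f :
  square_summable f <-> abs_summable (fun i => sqmod (f i)).
Proof.
rewrite /square_summable /abs_summable /summable.
suff -> : \esum_(i in [set: I]) `|(EFin \o (fun i => sqmod (f i))) i|%E =
          \esum_(i in [set: I]) (sqmod (f i))%:E by [].
by apply: eq_esum => i _ /=; rewrite ger0_norm ?sqmod_ge0.
Qed.

Lemma square_summable_le f g h (c : R) :
  (forall i, sqmod (f i) <= c * (sqmod (g i) + sqmod (h i))) ->
  square_summable g -> square_summable h -> square_summable f.
Proof.
move=> le /square_summableP sg /square_summableP sh; apply/square_summableP.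
apply: abs_summable_le (abs_summableZ c (abs_summableD sg sh)) => i /=.
by rewrite ger0_norm ?sqmod_ge0.
Qed.

Lemma square_summable0 : square_summable (fun=> 0).
Proof. by rewrite /square_summable esum1// => i _; rewrite /sqmod/= expr0n addr0. Qed.

Lemma square_summableD f g : square_summable f -> square_summable g ->
  square_summable (fun i => f i + g i).
Proof.
apply: (@square_summable_le _ _ _ 2) => i; rewrite /sqmod.
case: (f i) => a b; case: (g i) => c d /=.
have := sqr_ge0 (a - c); have := sqr_ge0 (b - d); lra.
Qed.

Lemma square_summableN f : square_summable f -> square_summable (fun i => - f i).
Proof.
move=> sf; apply: (square_summable_le (c := 1) _ sf sf) => i; rewrite /sqmod.
case: (f i) => a b /=.
have := sqr_ge0 a; have := sqr_ge0 b; lra.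
Qed.

Lemma square_summableZ (z : R[i]) f :
  square_summable f -> square_summable (fun i => z * f i).
Proof.
move=> sf; apply: (square_summable_le (c := sqmod z) _ sf sf) => i.
rewrite /sqmod; case: z => p q; case: (f i) => a b /=.
have := mulr_ge0 (sqmod_ge0 (Complex p q)) (sqmod_ge0 (Complex a b)).
rewrite /sqmod/=; lra.
Qed.

End ell2_def.

Record ell2 (R : realType) (I : choiceType) := Ell2 {
  ell2_fun :> I -> R[i];
  ell2P : square_summable ell2_fun }.

Section ell2_lmod.
Context {R : realType} {I : choiceType}.
Notation ell2 := (ell2 R I).
Implicit Types f g h : ell2.

Lemma ell2_ext f g : (forall i, f i = g i) -> f = g.
Proof.
case: f g => [f pf] [g pg] /= /funext fg; subst g.
by rewrite (Prop_irrelevance pf pg).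
Qed.

Lemma ell2_summable f : abs_summable (fun i => sqmod (f i)).
Proof. exact: (square_summableP f).1 (ell2P f). Qed.

HB.instance Definition _ := gen_eqMixin ell2.
HB.instance Definition _ := gen_choiceMixin ell2.

Definition ell2_zero : ell2 := Ell2 square_summable0.
Definition ell2_opp f : ell2 := Ell2 (square_summableN (ell2P f)).
Definition ell2_add f g : ell2 := Ell2 (square_summableD (ell2P f) (ell2P g)).
Definition ell2_scale (a : R[i]) f : ell2 := Ell2 (square_summableZ a (ell2P f)).

Fact ell2_addA : associative ell2_add.
Proof. by move=> f g h; apply: ell2_ext => i /=; rewrite addrA. Qed.
Fact ell2_addC : commutative ell2_add.
Proof. by move=> f g; apply: ell2_ext => i /=; rewrite addrC. Qed.
Fact ell2_add0 : left_id ell2_zero ell2_add.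
Proof. by move=> f; apply: ell2_ext => i /=; rewrite add0r. Qed.
Fact ell2_addN : left_inverse ell2_zero ell2_opp ell2_add.
Proof. by move=> f; apply: ell2_ext => i /=; rewrite addNr. Qed.
HB.instance Definition _ :=
  GRing.isZmodule.Build ell2 ell2_addA ell2_addC ell2_add0 ell2_addN.

Fact ell2_scaleA a b f : ell2_scale a (ell2_scale b f) = ell2_scale (a * b) f.
Proof. by apply: ell2_ext => i /=; rewrite mulrA. Qed.
Fact ell2_scale1 : left_id 1 ell2_scale.
Proof. by move=> f; apply: ell2_ext => i /=; rewrite mul1r. Qed.
Fact ell2_scaleDr : right_distributive ell2_scale +%R.
Proof. by move=> a f g; apply: ell2_ext => i /=; rewrite mulrDr. Qed.
Fact ell2_scaleDl f : {morph (ell2_scale^~ f) : a b / a + b}.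
Proof. by move=> a b; apply: ell2_ext => i /=; rewrite mulrDl. Qed.
HB.instance Definition _ := GRing.Zmodule_isLmodule.Build R[i] ell2
  ell2_scaleA ell2_scale1 ell2_scaleDr ell2_scaleDl.

Definition ell2_dot f g : R[i] := csum (fun i => f i * Num.conj (g i)).

Lemma ell2_dot_summable f g : csummable (fun i => f i * Num.conj (g i)).
Proof.
have sf := ell2_summable f; have sg := ell2_summable g.
split; apply: abs_summable_le (abs_summableD sf sg) => i /=;
  rewrite /sqmod; case: (f i) => a b; case: (g i) => c d /=;
  rewrite ler_norml;
  have := sqr_ge0 (a + c); have := sqr_ge0 (b + d);
  have := sqr_ge0 (a - c); have := sqr_ge0 (b - d);
  have := sqr_ge0 (a + d); have := sqr_ge0 (b + c);
  have := sqr_ge0 (a - d); have := sqr_ge0 (b - c);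
  move=> *; apply/andP; split; lra.
Qed.

Lemma ell2_dot_herm f g : ell2_dot f g = Num.conj (ell2_dot g f).
Proof.
rewrite /ell2_dot -(csum_conj (ell2_dot_summable g f)); congr csum.
by apply/funext => i; rewrite rmorphM /= conjCK mulrC.
Qed.

Lemma ell2_dot_linearl (a : R[i]) f g h :
  ell2_dot (a *: f + g) h = a * ell2_dot f h + ell2_dot g h.
Proof.
rewrite -(csum_linear a (ell2_dot_summable f h) (ell2_dot_summable g h)).
by congr csum; apply/funext => i /=; rewrite mulrDl mulrA.
Qed.

Lemma ell2_dot_linearr (a : R[i]) f g h :
  ell2_dot h (a *: f + g) = Num.conj a * ell2_dot h f + ell2_dot h g.
Proof.
by rewrite ell2_dot_herm ell2_dot_linearl rmorphD rmorphM /= -!ell2_dot_herm.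
Qed.

Definition ell2_sqnorm f : R := rsum (fun i => sqmod (f i)).

Lemma ell2_sqnorm_ge f i : sqmod (f i) <= ell2_sqnorm f.
Proof.
apply: (@rsum_ge_term _ _ (fun i => sqmod (f i))) => [j|]; first exact: sqmod_ge0.
by exact: ell2_summable.
Qed.

Lemma ell2_sqnorm_ge0 f : 0 <= ell2_sqnorm f.
Proof. by apply: rsum_ge0 => i; exact: sqmod_ge0. Qed.

Lemma ell2_dotE f : ell2_dot f f = (ell2_sqnorm f)%:C%C.
Proof.
rewrite /ell2_dot /csum; congr Complex.
  by congr rsum; apply/funext => i; rewrite /sqmod; case: (f i) => a b /=; ring.
rewrite -[RHS](mul0r (ell2_sqnorm f)) -rsumZ; last first.
  by exact: ell2_summable.
by congr rsum; apply/funext => i; rewrite /sqmod; case: (f i) => a b /=; ring.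
Qed.

Lemma ell2_dot_gt0 f : f != 0 -> 0 < ell2_dot f f.
Proof.
move=> f0; rewrite ell2_dotE ltcR lt_def ell2_sqnorm_ge0 andbT.
apply: contra f0 => /eqP f0; apply/eqP/ell2_ext => i.
have := ell2_sqnorm_ge f i; rewrite f0 /sqmod => h.
have : sqmod (f i) == 0 by rewrite eq_le h sqmod_ge0.
rewrite /sqmod paddr_eq0 ?sqr_ge0// !sqrf_eq0 => /andP[/eqP a0 /eqP b0].
by apply/eqP; rewrite eq_complex a0 b0 /= !eqxx.
Qed.

HB.instance Definition _ := @bilinear_isBilinear.Build R[i] ell2 ell2 R[i]
  *%R (Num.conj \; *%R) ell2_dot
  (conj (fun h a f g => ell2_dot_linearl a f g h)
        (fun h a f g => ell2_dot_linearr a f g h)).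
Fact ell2_hermitian f g :
  ell2_dot f g = (-1) ^+ false * Num.conj (ell2_dot g f).
Proof. by rewrite expr0 mul1r; exact: ell2_dot_herm. Qed.
HB.instance Definition _ := @isHermitianSesquilinear.Build R[i] ell2 false
  Num.conj ell2_dot ell2_hermitian.
HB.instance Definition _ := @isDotProduct.Build R[i] ell2 ell2_dot ell2_dot_gt0.

Definition ell2_norm f : R[i] := (Num.sqrt (ell2_sqnorm f))%:C%C.

Lemma ell2_dot_norm f : ell2_dot f f = ell2_norm f ^+ 2.
Proof. by rewrite ell2_dotE -rmorphXn /= sqr_sqrtr ?ell2_sqnorm_ge0. Qed.

Lemma ell2_norm_ge0 f : 0 <= ell2_norm f.
Proof. by rewrite lecR sqrtr_ge0. Qed.

Fact ell2_normD f g : ell2_norm (f + g) <= ell2_norm f + ell2_norm g.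
Proof.
exact: (dot_triangle (form := ell2_dot) ell2_norm_ge0 ell2_dot_norm).
Qed.

Fact ell2_normZ (a : R[i]) f : ell2_norm (a *: f) = `|a| * ell2_norm f.
Proof.
apply/eqP; rewrite -(@eqrXn2 _ 2) ?mulr_ge0 ?ell2_norm_ge0//.
have h : ell2_dot (a *: f) (a *: f) = `|a| ^+ 2 * ell2_dot f f :=
  dnormZ ell2_dot a f.
by rewrite exprMn -!ell2_dot_norm h.
Qed.

Fact ell2_norm0_eq0 f : ell2_norm f = 0 -> f = 0.
Proof.
move=> f0; have h : (ell2_dot f f == 0) = (f == 0) := dnorm_eq0 ell2_dot f.
by apply/eqP; rewrite -h ell2_dot_norm f0 expr0n.
Qed.

HB.instance Definition _ := @Lmodule_isNormed.Build R[i] ell2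
  ell2_norm ell2_normD ell2_normZ ell2_norm0_eq0.

End ell2_lmod.

Section ell2_complete.
Context {R : realType} {I : choiceType}.
Notation ell2 := (ell2 R I).
Implicit Types f g h : ell2.

Lemma ell2_norm_lt f (e : R) : (`|f| < e%:C%C) -> forall i,
  `|complex.Re (f i)| < e /\ `|complex.Im (f i)| < e.
Proof.
move=> fe i; have {}fe : Num.sqrt (ell2_sqnorm f) < e by rewrite -ltcR.
have le := ell2_sqnorm_ge f i.
split; apply: le_lt_trans fe; rewrite -sqrtr_sqr ler_wsqrtr//;
  apply: le_trans le; rewrite /sqmod; first by rewrite lerDl sqr_ge0.
by rewrite lerDr sqr_ge0.
Qed.

Lemma ell2_psum_le f (e : R) (X : {fset I}) : `|f| < e%:C%C ->
  \sum_(i <- X) sqmod (f i) <= e ^+ 2.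
Proof.
move=> fe; have {}fe : Num.sqrt (ell2_sqnorm f) < e by rewrite -ltcR.
have e0 : 0 <= e by apply: le_trans (ltW fe); exact: sqrtr_ge0.
apply: (@le_trans _ _ (ell2_sqnorm f)); last first.
  rewrite -[leLHS]sqr_sqrtr ?ell2_sqnorm_ge0//.
  by rewrite ler_sqr ?nnegrE ?sqrtr_ge0// ltW.
have sf : abs_summable (fun i => sqmod (f i)).
  by exact: ell2_summable.
have f0 i : 0 <= sqmod (f i) := sqmod_ge0 _.
rewrite /ell2_sqnorm (rsum_ge0E f0) -lee_fin (fineK (abs_summable_fin f0 sf)).
apply: ereal_sup_ubound; exists [set` X]; first by split.
by rewrite -fsbig_seq ?fset_uniq// sumEFin.
Qed.

Lemma ell2_cauchy_cvg (F : set_system ell2) : ProperFilter F -> cauchy F -> cvg F.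
Proof.
move=> FF /cauchyP cF.
have cvg_coord (p : R[i] -> R) : {morph p : x y / x - y} ->
    (forall f (e : R), `|f| < e%:C%C -> forall i, `|p (f i)| < e) ->
    forall i, cvg ((fun f : ell2 => p (f i)) @ F).
  move=> pB p_lt i; apply: cauchy_cvg; apply/cauchyP => e e0.
  have [f Ff] := cF e%:C%C ltac:(by rewrite ltcR).
  exists (p (f i)); 
  suff : F (fun g : ell2 => ball (p (f i)) e (p (g i))) by [].
  apply: filterS Ff => g.
  rewrite -ball_normE /= => /p_lt/(_ i) h.
  have {}h : `|p (f i) - p (g i)| < e by rewrite -pB.
  exact: h.
have cre : forall i, cvg ((fun f : ell2 => complex.Re (f i)) @ F).
  apply: cvg_coord => [[a b] [c d]//|f e fe i].
  by have [] := ell2_norm_lt fe i.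
have cim : forall i, cvg ((fun f : ell2 => complex.Im (f i)) @ F).
  apply: cvg_coord => [[a b] [c d]//|f e fe i].
  by have [] := ell2_norm_lt fe i.
pose l i : R[i] := Complex (lim ((fun f : ell2 => complex.Re (f i)) @ F))
                           (lim ((fun f : ell2 => complex.Im (f i)) @ F)).
have cvg_fsum (r : seq I) (u : I -> ell2 -> R) (v : I -> R) :
    (forall i, u i @ F --> v i) ->
    (fun g => \sum_(i <- r) u i g) @ F --> \sum_(i <- r) v i.
  move=> uv; elim: r => [|i r IH].
    by rewrite big_nil; under eq_fun do rewrite big_nil; exact: cvg_cst.
  by rewrite big_cons; under eq_fun do rewrite big_cons; exact: cvgD.
have psum_le f (e : R) (X : {fset I}) : F (ball f e%:C%C) ->
    \sum_(i <- X) sqmod (f i - l i) <= e ^+ 2.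
  move=> Ff; pose s (g : ell2) := \sum_(i <- X) sqmod (f i - g i).
  apply: (@cvgr_to_le _ F _ R s); last first.
    by apply: filterS Ff => g; rewrite -ball_normE => h;
      exact: (@ell2_psum_le (f - g) e X h).
  rewrite /s; apply: cvg_fsum => i; rewrite /sqmod.
  have -> : (fun g : ell2 =>
      complex.Re (f i - g i) ^+ 2 + complex.Im (f i - g i) ^+ 2) =
    (fun g : ell2 => (complex.Re (f i) - complex.Re (g i)) ^+ 2 +
                       (complex.Im (f i) - complex.Im (g i)) ^+ 2).
    by apply/funext => g; case: (f i) (g i) => a b [c d].
  rewrite [X in _ --> X](_ : _ = (complex.Re (f i) - complex.Re (l i)) ^+ 2 +
                       (complex.Im (f i) - complex.Im (l i)) ^+ 2); last first.
    by case: (f i) => a b.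
  apply: cvgD; rewrite !expr2; apply: cvgM; apply: cvgB;
    by [exact: cvg_cst|exact: cre|exact: cim].
have sq_le f (e : R) : F (ball f e%:C%C) ->
    (\esum_(i in [set: I]) (sqmod (f i - l i))%:E <= (e ^+ 2)%:E)%E.
  move=> Ff; apply: ge_ereal_sup => _ [X [finX _] <-].
  rewrite fsbig_finite//= sumEFin lee_fin; exact: psum_le.
have [f1 Ff1] := cF 1 ltr01.
have s1 : square_summable (fun i => f1 i - l i).
  by apply: le_lt_trans (sq_le f1 1 Ff1) _; rewrite ltry.
pose L : ell2 := f1 - Ell2 s1.
have LE i : L i = l i by rewrite /L /= opprB addrC subrK.
have norm_le f (e : R) : 0 <= e -> F (ball f e%:C%C) -> `|f - L| <= e%:C%C.
  move=> e0 /sq_le le; suff : Num.sqrt (ell2_sqnorm (f - L)) <= e by rewrite -lecR.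
  rewrite -(ger0_norm e0) -sqrtr_sqr ler_wsqrtr// /ell2_sqnorm.
  have s0 i : 0 <= sqmod ((f - L) i) := sqmod_ge0 _.
  have ss : abs_summable (fun i => sqmod ((f - L) i)).
    by exact: ell2_summable.
  rewrite (rsum_ge0E s0) -lee_fin (fineK (abs_summable_fin s0 ss)).
  apply: le_trans le; rewrite le_eqVlt; apply/orP; left; apply/eqP.
  by apply: eq_esum => i _; rewrite -LE.
apply/cvg_ex; exists L; apply/cvgrPdist_lt => e e0.
have e20 : 0 < e / 2 by rewrite divr_gt0.
have e2R : e / 2 = (complex.Re (e / 2))%:C%C by rewrite RRe_real// gtr0_real.
have [f Ff] := cF _ e20.
have le : `|f - L| <= e / 2.
  by rewrite e2R; apply: norm_le; rewrite -?lecR -e2R// ltW.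
apply: filterS Ff => g; rewrite -ball_normE /= => fg.
rewrite (_ : L - g = (f - g) - (f - L)); last by rewrite opprB [RHS]addrC addrA subrK.
by rewrite (le_lt_trans (ler_normB _ _))// (splitr e) ltr_leD.
Qed.

HB.instance Definition _ := Uniform_isComplete.Build ell2 ell2_cauchy_cvg.
HB.instance Definition _ := @isHilbert.Build R ell2 ell2_dot ell2_dot_norm.

End ell2_complete.

Section adjoint.
Context {R : realType} {H : hilbertType R}.
Implicit Types (S T p q : bop H) (A X : set (bop H)).

Definition is_adjoint T S := forall x y : H, hdot (T x) y = hdot x (S y).

(* The adjoint is unique, and exists by the Riesz representation theorem; the
   default value 0 is never used. *)
Definition adjoint T : bop H := xget 0 [set S | is_adjoint T S].

Lemma is_adjoint_unique T S S' : is_adjoint T S -> is_adjoint T S' -> S = S'.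
Proof.
move=> TS TS'; apply/bopP => y; apply/eqP; rewrite -subr_eq0.
rewrite -(dnorm_eq0 (@hdot R H)) /= linearBr /=.
by rewrite -TS -TS' subrr.
Qed.

Lemma is_adjointE T S : is_adjoint T S -> adjoint T = S.
Proof.
move=> TS; apply: is_adjoint_unique (TS).
exact: (xgetPex 0 (ex_intro _ _ TS : exists S, [set S | is_adjoint T S] S)).
Qed.

Definition partial_isometry T := T * adjoint T * T = T.

Definition projection p := p * p = p /\ adjoint p = p.

(* q dominates p when the range of p is contained in that of q *)
Definition proj_le p q := q * p = p.

(* closed for the operator norm: |S - T| <= e is spelt out pointwise *)
Definition norm_closed A := forall T,
  (forall e : R, 0 < e ->
     exists2 S, A S & forall x, `|S x - T x| <= e%:C%C * `|x|) -> A T.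

Record cstar_subalgebra A : Prop := CStarSubalgebra {
  cstar0 : A 0;
  cstarD : forall S T, A S -> A T -> A (S + T);
  cstarZ : forall (c : R[i]) S, A S -> A (c *: S);
  cstarM : forall S T, A S -> A T -> A (S * T);
  cstar_adj : forall S, A S -> A (adjoint S);
  cstar_closed : norm_closed A }.

Definition cstar_gen X : set (bop H) :=
  \bigcap_(A in [set A | cstar_subalgebra A /\ X `<=` A]) A.

Definition projections_in A : set (bop H) := [set p | A p /\ projection p].

(* u is the supremum of X in the poset A of projections *)
Definition is_proj_sup A X u :=
  [/\ A u, forall p, X p -> proj_le p u
    & forall q, A q -> (forall p, X p -> proj_le p q) -> proj_le u q].

End adjoint.

Section tightness.
Context {R : realType} {K H : hilbertType R}.
Implicit Types (S E Y Z : set (bop K)) (sigma : bop K -> bop H).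

(* A representation is a function on S; the values of sigma outside of S are
   irrelevant. *)
Record unital_representation S sigma : Prop := UnitalRepresentation {
  rep1 : sigma 1 = 1;
  rep0 : sigma 0 = 0;
  repM : forall a b, S a -> S b -> sigma (a * b) = sigma a * sigma b;
  rep_adj : forall a, S a -> sigma (adjoint a) = adjoint (sigma a);
  rep_partial_isometry : forall a, S a -> partial_isometry (sigma a) }.

Definition is_cover Z Y :=
  Z `<=` Y /\ forall z, Y z -> z <> 0 -> exists2 f, Z f & f * z <> 0.

Definition below E x : set (bop K) := [set z | E z /\ proj_le z x].

(* The supremum is taken in the Boolean algebra of projections of the
   C*-algebra generated by sigma(E). *)
Definition tight_on E sigma := forall x Z, E x -> finite_set Z ->
  is_cover Z (below E x) ->
  is_proj_sup (projections_in (cstar_gen (sigma @` E))) (sigma @` Z) (sigma x).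

End tightness.

Section cone_order.
Local Open Scope group_scope.
Context {G : groupType} (C : set G).

Definition cone_le (x y : G) := C (x^-1 * y).

Definition is_lub_in (A : set G) (m : G) :=
  [/\ C m, forall x, A x -> cone_le x m
    & forall u, C u -> (forall x, A x -> cone_le x u) -> cone_le m u].

End cone_order.

Record quasi_lattice (G : groupType) := QuasiLattice {
  cone : set G;
  cone1 : cone 1%g;
  coneM : forall x y, cone x -> cone y -> cone (x * y)%g;
  cone_pointed : forall x, cone x -> cone x^-1%g -> x = 1%g;
  cone_lub1 : forall s t, cone s -> cone t ->
    exists m, is_lub_in cone [set (s * t^-1)%g] m;
  cone_lub2 : forall s t, cone s -> cone t ->
    (exists u, [/\ cone u, cone_le cone s u & cone_le cone t u]) ->
    exists m, is_lub_in cone [set s; t] m }.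

Definition semigroup_of (G : groupType) (P : quasi_lattice G) : Type :=
  set_type (cone P).
Coercion semigroup_of : quasi_lattice >-> Sortclass.
HB.instance Definition _ (G : groupType) (P : quasi_lattice G) :=
  SubChoice.copy (semigroup_of P) {x | x \in cone P}.

Section semigroup.
Context {G : groupType} {P : quasi_lattice G}.
Implicit Types s t r : P.

Lemma semigroupP s : cone P (val s). Proof. exact/set_mem/(valP s). Qed.

Definition mk_semigroup (x : G) (Px : cone P x) : P := SigSub (mem_set Px).

Definition semigroup_one : P := mk_semigroup (cone1 P).
Definition semigroup_mul s t : P :=
  mk_semigroup (coneM (semigroupP s) (semigroupP t)).

Fact semigroup_mulA : associative semigroup_mul.
Proof. by move=> s t r; apply: val_inj; rewrite /= mulgA. Qed.
Fact semigroup_mul1 : left_id semigroup_one semigroup_mul.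
Proof. by move=> s; apply: val_inj; rewrite /= mul1g. Qed.
Fact semigroup_1mul : right_id semigroup_one semigroup_mul.
Proof. by move=> s; apply: val_inj; rewrite /= mulg1. Qed.
HB.instance Definition _ :=
  isMonoid.Build P semigroup_mulA semigroup_mul1 semigroup_1mul.

Definition common_ub s t :=
  exists r, cone_le (cone P) (val s) (val r) /\
    cone_le (cone P) (val t) (val r).

Definition is_least_common_ub s t r :=
  is_lub_in (cone P) [set val s; val t] (val r).

(* the default value 1 is only taken when s and t have no common upper bound *)
Definition least_common_ub s t : P :=
  xget 1%g [set r | is_least_common_ub s t r].

Lemma least_common_ubP s t : common_ub s t ->
  is_least_common_ub s t (least_common_ub s t).
Proof.
move=> [u [su tu]].
have [|m mP] := cone_lub2 (semigroupP s) (semigroupP t).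
  by exists (val u); split=> //; exact: semigroupP.
have [mC _ _] := mP.
suff h : exists r, [set r | is_least_common_ub s t r] r
  by exact: (xgetPex 1%g h).
by exists (mk_semigroup mC).
Qed.

Definition covers_semigroup (F : {fset P}) :=
  forall x : P, exists2 y, y \in F & common_ub x y.

End semigroup.

Section left_regular.
Context {R : realType} {G : groupType} {P : quasi_lattice G}.
Implicit Types (s t : P) (f : ell2 R P).

(* (W t f) (t * y) = f y, and W t f vanishes off t P *)
Definition W_fun t (f : P -> R[i]) (x : P) : R[i] :=
  oapp f 0 (insub ((val t)^-1 * val x)%g).

Lemma W_funM t (f : P -> R[i]) y : W_fun t f (t * y)%g = f y.
Proof. by rewrite /W_fun /= mulKg valK. Qed.

Lemma W_fun_out t (f : P -> R[i]) x : ~ range (fun y => t * y)%g x ->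
  W_fun t f x = 0.
Proof.
move=> tx; rewrite /W_fun; case: insubP => //= y _ yE; case: tx.
by exists y => //; apply: val_inj; rewrite /= yE mulVKg.
Qed.

Lemma semigroup_mul_inj t : injective (fun y : P => t * y)%g.
Proof. by move=> x y /(congr1 val) /= /mulgI /val_inj. Qed.

Lemma esum_W t (f : P -> R[i]) :
  \esum_(x in [set: P]) (sqmod (W_fun t f x))%:E
  = \esum_(x in [set: P]) (sqmod (f x))%:E.
Proof.
rewrite (esumID (range (fun y => t * y)%g)); last first.
  by move=> x _; rewrite lee_fin sqmod_ge0.
rewrite !setTI [X in (_ + X)%E](_ : _ = 0)%E ?adde0; last first.
  apply: esum1 => x /= tx; rewrite W_fun_out// /sqmod/= expr0n addr0//.
rewrite esum_image; last by move=> x y _ _; exact: semigroup_mul_inj.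
by apply: eq_esum => x _; rewrite /= W_funM.
Qed.

Fact W_summable t f : square_summable (W_fun t f).
Proof. by rewrite /square_summable esum_W; exact: ell2P. Qed.

Definition W_ell2 t f : ell2 R P := Ell2 (W_summable t f).

Lemma W_norm t f : `|W_ell2 t f| = `|f|.
Proof.
suff h : ell2_sqnorm (W_ell2 t f) = ell2_sqnorm f.
  by congr (Num.sqrt _)%:C%C.
rewrite /ell2_sqnorm !rsum_ge0E/= ?esum_W// => i; exact: sqmod_ge0.
Qed.

Fact W_linear t : linear (W_ell2 t).
Proof.
move=> a f g; apply: ell2_ext => x /=; rewrite /W_fun.
by case: insub => //=; rewrite mulr0 addr0.
Qed.

Fact W_continuous t : continuous (W_ell2 t).
Proof.
move=> f; apply/(@cvgrPdist_lt _ _ _ (nbhs f)) => e e0.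
apply: filterS (nbhsx_ballx f e e0) => g.
rewrite -ball_normE /= => fg.
have -> : W_ell2 t f - W_ell2 t g = W_ell2 t (f - g).
  by rewrite -scaleN1r addrC -W_linear scaleN1r addrC.
by rewrite W_norm.
Qed.

Definition W t : bop (ell2 R P) := Bop (W_linear t) (@W_continuous t).

Fact ell2_delta_summable (a : P) :
  square_summable (fun x : P => (x == a)%:R : R[i]).
Proof.
rewrite /square_summable (esumID [set a]); last first.
  by move=> x _; rewrite lee_fin sqmod_ge0.
rewrite setTI esum_set1 ?lee_fin ?sqmod_ge0//.
rewrite esum1 ?adde0 ?ltry// => x [_ /= /eqP/negbTE ->].
by rewrite /sqmod/= expr0n addr0.
Qed.

Definition delta (a : P) : ell2 R P := Ell2 (ell2_delta_summable a).

Lemma W_delta t a : W t (delta a) = delta (t * a)%g.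
Proof.
apply: ell2_ext => x /=.
have [[y _ <-]|tx] := pselect (range (fun y => t * y)%g x).
  by rewrite W_funM (inj_eq (@semigroup_mul_inj t)).
by rewrite W_fun_out//; case: eqP => // xE; case: tx; exists a.
Qed.

Definition nica_semigroup : set (bop (ell2 R P)) :=
  [set A | A = 0 \/ exists s t, A = W s * adjoint (W t)].

Definition nica_projections : set (bop (ell2 R P)) :=
  [set A | A = 0 \/ exists t, A = W t * adjoint (W t)].

End left_regular.

Section covariance.
Context {R : realType} {G : groupType} {P : quasi_lattice G}.
Context {H : hilbertType R}.
Implicit Types V : P -> bop H.

Definition range_proj V (t : P) : bop H := V t * adjoint (V t).

Record isometric_representation V : Prop := IsometricRepresentation {
  isom_rep1 : V 1%g = 1;
  isom_repM : forall s t, V (s * t)%g = V s * V t;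
  isom_rep_isometry : forall t, adjoint (V t) * V t = 1 }.

Record nica_covariant V : Prop := NicaCovariant {
  nica_isometric : isometric_representation V;
  nica_meet : forall s t, common_ub s t ->
    range_proj V s * range_proj V t = range_proj V (least_common_ub s t);
  nica_disjoint : forall s t, ~ common_ub s t ->
    range_proj V s * range_proj V t = 0 }.

(* sigma is determined by V on nica_semigroup *)
Definition tight V := exists sigma : bop (ell2 R P) -> bop H,
  [/\ unital_representation nica_semigroup sigma,
      forall s t, sigma (W s * adjoint (W t)) = V s * adjoint (V t)
    & tight_on nica_projections sigma].

End covariance.

(* Main.v *)
Require Import Defs.
From mathcomp Require Import all_boot all_order all_algebra finmap.
From mathcomp Require Import boolp classical_sets reals topology normedtype.
From mathcomp Require Import complex functions cardinality esum numfun ereal.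
Set Implicit Arguments.
Unset Strict Implicit.
Unset Printing Implicit Defensive.
Import Order.TTheory GRing.Theory Num.Theory.
Local Open Scope classical_set_scope.
Local Open Scope ring_scope.

(** Write [L(t) = V(t) V(t)^*]. Everything rests on two remarks.

    A finite set [F] covers the semigroup exactly when the projections
    [W(t) W(t)^*], [t] in [F], cover the interval below 1, because a product
    of two range projections of the left regular representation is nonzero
    exactly when the two elements have a common upper bound
    ([W_nica_covariant]). So if [V] is tight, 1 is the supremum of the [L(t)],
    [t] in [F]. The projection [1 - \prod (1 - L(t))] is an upper bound of these
    [L(t)] ([compl_prod_range_proj]) and lies in the C*-algebra that they
    generate; hence it equals 1 and the product vanishes ([tight_prod0]).

    Conversely, the covers of the other intervals are translates of covers of
    the semigroup: the projections below [W(t) W(t)^*] are 0 and those of the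
    elements [t a], and if finitely many of them cover that interval, then the
    corresponding [a] form a set [F] which covers the semigroup
    ([cover_quotient_covers]). Let [q] dominate all [L(t a)], [a] in [F]. As
    [L(t a) = V(t) L(a) V(t)^*], the operator [(1 - q) V(t)] is killed by each
    [L(a)], so it is unchanged by right multiplication by the product of the
    [1 - L(a)], which is 0 by assumption. Thus [(1 - q) V(t) = 0], that is,
    [q] dominates [L(t)] ([prod0_tight_on]).

    The representation of the inverse semigroup that goes with [V] is
    well defined because [W(s) W(t)^*] is nonzero and determines [s] and [t]
    ([W_rank_inj]). It is multiplicative because for every Nica-covariant
    representation [V(s)^* V(t)] is either 0 or [V(a) V(b)^*], where
    [s a = t b] is the least common upper bound, and [a] and [b] depend only on
    [s] and [t] ([nica_adjoint_meet], [nica_adjoint_disjoint]); this is applied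
    to both [V] and [W]. *)

(** * Adjoints, projections and generated C*-algebras *)

Section adjoint_algebra.
Context {R : realType} {H : hilbertType R}.
Implicit Types (S T p q : bop H) (A X : set (bop H)).

Lemma bop_zeroE (x : H) : (0 : bop H) x = 0. Proof. by []. Qed.
Lemma bop_mulE S T (x : H) : (S * T) x = S (T x). Proof. by []. Qed.

Lemma is_adjoint_sym S T : is_adjoint S T -> is_adjoint T S.
Proof.
move=> ST x y; rewrite (hermC (@hdot R H) (T x)) (hermC (@hdot R H) x) /=.
by congr (_ * Num.conj _); rewrite ST.
Qed.

Lemma is_adjointM S S' T T' :
  is_adjoint S S' -> is_adjoint T T' -> is_adjoint (S * T) (T' * S').
Proof. by move=> SS' TT' x y; rewrite !bop_mulE SS' TT'. Qed.

Lemma is_adjoint0 : is_adjoint (0 : bop H) 0.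
Proof. by move=> x y; rewrite !bop_zeroE linear0l linear0r. Qed.

Lemma is_adjoint1 : is_adjoint (1 : bop H) 1.
Proof. by []. Qed.

Lemma is_adjointB S S' T T' :
  is_adjoint S S' -> is_adjoint T T' -> is_adjoint (S - T) (S' - T').
Proof.
move=> SS' TT' x y; rewrite -[(S - T) x]/(S x - T x).
by rewrite -[(S' - T') y]/(S' y - T' y) linearBl linearBr /= SS' TT'.
Qed.

(** If [T] had no adjoint, then [adjoint T]
    would be 0, so [1 = 0] and the Hilbert space would be trivial. *)
Lemma isometry_is_adjoint T :
  adjoint T * T = 1 -> is_adjoint T (adjoint T).
Proof.
have [[S TS] _|noS] := pselect (exists S, is_adjoint T S).
  by rewrite (is_adjointE TS).
have -> : adjoint T = 0 by apply: xgetPN => S TS; apply: noS; exists S.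
rewrite mul0r => E01 x y.
have H0 (z : H) : z = 0 by rewrite -[z]/((1 : bop H) z) -E01.
by rewrite (H0 (T x)) (H0 x) !linear0l.
Qed.

(** An operator without adjoint satisfies [adjoint p = p] only if it equals the
    default value 0, which is self-adjoint; so this equation always means that
    [p] is self-adjoint. *)
Lemma projectionP p : projection p <-> p * p = p /\ is_adjoint p p.
Proof.
split=> -[pp pA]; split=> //; last exact: is_adjointE.
have [[S pS]|noS] := pselect (exists S, is_adjoint p S).
  by rewrite -{2}pA (is_adjointE pS).
rewrite (_ : p = 0); first exact: is_adjoint0.
by rewrite -pA; apply: xgetPN => S pS; apply: noS; exists S.
Qed.

Lemma projection0 : projection (0 : bop H).
Proof. by apply/projectionP; rewrite mulr0; split => //; exact: is_adjoint0. Qed.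

Lemma projection1 : projection (1 : bop H).
Proof. by apply/projectionP; rewrite mulr1; split => //; exact: is_adjoint1. Qed.

Lemma projection_compl p : projection p -> projection (1 - p).
Proof.
move=> /projectionP[pp pA]; apply/projectionP; split.
  by rewrite mulrBl mul1r mulrBr mulr1 pp subrr subr0.
exact: is_adjointB is_adjoint1 pA.
Qed.

Lemma projectionM p q :
  projection p -> projection q -> GRing.comm p q -> projection (p * q).
Proof.
move=> /projectionP[pp pA] /projectionP[qq qA] pq; apply/projectionP; split.
  by rewrite mulrA -(mulrA p q p) -pq mulrA pp -mulrA qq.
by rewrite {2}pq; exact: is_adjointM.
Qed.

Lemma projection_prod (I : Type) (s : seq I) (p : I -> bop H) :
  (forall i, projection (p i)) -> (forall i j, GRing.comm (p i) (p j)) ->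
  projection (\prod_(i <- s) p i).
Proof.
move=> pP pC; elim: s => [|i s IH]; first by rewrite big_nil; exact: projection1.
by rewrite big_cons; apply: projectionM => //; exact: commr_prod.
Qed.

Lemma cstar_gen_subalgebra X : cstar_subalgebra (cstar_gen X).
Proof.
split=> [A [Aalg _]|S T XS XT A AX|c S XS A AX|S T XS XT A AX|S XS A AX
  |T XT A AX].
- exact: cstar0.
- by case: (AX) => Aalg _; apply: cstarD => //; [exact: XS|exact: XT].
- by case: (AX) => Aalg _; apply: cstarZ => //; exact: XS.
- by case: (AX) => Aalg _; apply: cstarM => //; [exact: XS|exact: XT].
- by case: (AX) => Aalg _; apply: cstar_adj => //; exact: XS.
- case: (AX) => Aalg _; apply: cstar_closed => // e e0.
  by have [S XS ST] := XT e e0; exists S => //; exact: XS.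
Qed.

Lemma sub_cstar_gen X : X `<=` cstar_gen X.
Proof. by move=> T XT A [_]; apply. Qed.

Lemma cstar_subalgebraB A S T : cstar_subalgebra A -> A S -> A T -> A (S - T).
Proof.
by move=> Aalg AS AT; rewrite -scaleN1r; apply: cstarD => //; exact: cstarZ.
Qed.

Lemma cstar_subalgebra_prod A (I : Type) (s : seq I) (p : I -> bop H) :
  cstar_subalgebra A -> A 1 -> (forall i, A (p i)) -> A (\prod_(i <- s) p i).
Proof. by move=> Aalg A1 Ap; apply: big_ind => // S T; exact: cstarM. Qed.

End adjoint_algebra.

(** * Divisibility in the semigroup *)

Section divisibility.
Context {G : groupType} {P : quasi_lattice G}.
Implicit Types s t r a b : P.

Lemma cone_leP s r : cone_le (cone P) (val s) (val r) <-> exists a, r = (s * a)%g.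
Proof.
split=> [sr|[a ->]]; last by rewrite /cone_le /= mulKg; exact: semigroupP.
by exists (mk_semigroup sr); apply: val_inj; rewrite /= mulVKg.
Qed.

Lemma common_ubP s t : common_ub s t <-> exists a b, (s * a = t * b)%g.
Proof.
split=> [[r [/cone_leP[a ->] /cone_leP[b ab]]]|[a [b ab]]]; first by exists a, b.
by exists (s * a)%g; split; apply/cone_leP; [exists a|exists b].
Qed.

Lemma common_ubC s t : common_ub s t -> common_ub t s.
Proof. by move=> [r [sr tr]]; exists r. Qed.

Lemma least_common_ubC s t : least_common_ub s t = least_common_ub t s.
Proof. by rewrite /least_common_ub /is_least_common_ub setUC. Qed.

Lemma least_common_ub_dvd s t : common_ub s t ->
  exists a b, (s * a)%g = least_common_ub s t /\ (t * b)%g = least_common_ub s t.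
Proof.
move=> /least_common_ubP lub; have [_ ub _] := lub.
have /cone_leP[a sa] := ub _ (or_introl erefl).
have /cone_leP[b tb] := ub _ (or_intror erefl).
by exists a, b; rewrite -sa -tb.
Qed.

Lemma least_common_ub_min s t a b : (s * a = t * b)%g ->
  exists c, (s * a = least_common_ub s t * c)%g.
Proof.
move=> ab; have /least_common_ubP lub : common_ub s t.
  by apply/common_ubP; exists a, b.
have [_ _ mn] := lub; apply/cone_leP/mn; first exact: semigroupP.
by move=> _ [->|->]; apply/cone_leP; [exists a|exists b].
Qed.

(** Here [b] is the inverse of [a], so pointedness of the cone applies. *)
Lemma dvd_anti s t a b : s = (t * a)%g -> t = (s * b)%g -> s = t.
Proof.
move=> sE tE; have /(congr1 val)/= ab1 : (a * b)%g = 1%g.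
  by apply: (@semigroup_mul_inj G P t); rewrite mulgA -sE -tE mulg1.
rewrite sE (_ : a = 1%g) ?mulg1//; apply: val_inj => /=.
apply: (cone_pointed (semigroupP a)).
have <- : val b = (val a)^-1%g by rewrite -(mulKg (val a) (val b)) ab1 mulg1.
exact: semigroupP.
Qed.

End divisibility.

(** * The left regular representation is Nica-covariant *)

Section left_regular_representation.
Context {R : realType} {G : groupType} {P : quasi_lattice G}.
Implicit Types (s t : P) (f g : ell2 R P).

Lemma esum_supp (I J : choiceType) (e : J -> I) (h : I -> \bar R) :
  injective e -> (forall i, (0 <= h i)%E) -> (forall i, ~ range e i -> h i = 0%E) ->
  \esum_(i in [set: I]) h i = \esum_(j in [set: J]) h (e j).
Proof.
move=> e_inj h0 h_out; rewrite (esumID (range e)); last by move=> i _.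
rewrite !setTI [X in (_ + X)%E]esum1 ?adde0//.
by rewrite esum_image// => x y _ _; exact: e_inj.
Qed.

Lemma rsum_supp (I J : choiceType) (e : J -> I) (h : I -> R) :
  injective e -> (forall i, ~ range e i -> h i = 0) ->
  rsum h = rsum (h \o e).
Proof.
move=> e_inj h_out; rewrite /rsum; congr (fine (_ - _)%E).
  rewrite (esum_supp (h := ((EFin \o h)^\+)%E) e_inj) => [|i|i /h_out hi].
  - by apply: eq_esum => j _; rewrite !funeposE.
  - exact: funepos_ge0.
  - by rewrite funeposE /= hi maxxx.
rewrite (esum_supp (h := ((EFin \o h)^\-)%E) e_inj) => [|i|i /h_out hi].
- by apply: eq_esum => j _; rewrite !funenegE.
- exact: funeneg_ge0.
- by rewrite funenegE /= hi oppr0 maxxx.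
Qed.

Lemma W_adj_esum_le t (f : P -> R[i]) :
  (\esum_(x in [set: P]) (sqmod (f (t * x)%g))%:E <=
   \esum_(x in [set: P]) (sqmod (f x))%:E)%E.
Proof.
rewrite [leRHS](esumID (range (fun y => t * y)%g)); last first.
  by move=> x _; rewrite lee_fin sqmod_ge0.
rewrite !setTI esum_image; last by move=> x y _ _; exact: semigroup_mul_inj.
by rewrite leeDl// esum_ge0// => x _; rewrite lee_fin sqmod_ge0.
Qed.

Fact W_adj_summable t f : square_summable (fun x => f (t * x)%g).
Proof. exact: le_lt_trans (W_adj_esum_le t f) (ell2P f). Qed.

Definition W_adj_ell2 t f : ell2 R P := Ell2 (W_adj_summable t f).

Lemma W_adj_norm t f : `|W_adj_ell2 t f| <= `|f|.
Proof.
suff h : ell2_sqnorm (W_adj_ell2 t f) <= ell2_sqnorm f.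
  by rewrite lecR ler_wsqrtr.
have sq0 (u : ell2 R P) x : 0 <= sqmod (u x) by exact: sqmod_ge0.
rewrite /ell2_sqnorm !rsum_ge0E// fine_le ?W_adj_esum_le//;
  by apply: abs_summable_fin => //; exact: ell2_summable.
Qed.

Fact W_adj_linear t : linear (W_adj_ell2 t).
Proof. by move=> a f g; apply: ell2_ext. Qed.

Fact W_adj_continuous t : continuous (W_adj_ell2 t).
Proof.
move=> f; apply/(@cvgrPdist_lt _ _ _ (nbhs f)) => e e0.
apply: filterS (nbhsx_ballx f e e0) => g; rewrite -ball_normE /=.
by apply: le_lt_trans; exact: W_adj_norm t (f - g).
Qed.

Definition W_adj t : bop (ell2 R P) := Bop (W_adj_linear t) (@W_adj_continuous t).

Lemma W_is_adjoint t : is_adjoint (W t) (W_adj t).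
Proof.
move=> f g; rewrite -[LHS]/(csum _) -[RHS]/(csum _).
have out x : ~ range (fun y => t * y)%g x -> W_fun t f x * Num.conj (g x) = 0.
  by move=> tx; rewrite W_fun_out// mul0r.
rewrite /csum; congr Complex; rewrite (rsum_supp (@semigroup_mul_inj G P t)).
- by congr rsum; apply/funext => x /=; rewrite W_funM.
- by move=> x /out ->.
- by congr rsum; apply/funext => x /=; rewrite W_funM.
- by move=> x /out ->.
Qed.

Lemma adjoint_W t : adjoint (W t) = W_adj t.
Proof. exact: is_adjointE (@W_is_adjoint t). Qed.

(** This lemma and the next one say that [W(t) W(t)^*] is multiplication by the
    indicator function of the right ideal [t P]. *)
Lemma range_proj_WM t f x : range_proj W t f (t * x)%g = f (t * x)%g.
Proof. by rewrite /range_proj adjoint_W /= W_funM. Qed.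

Lemma range_proj_W_out t f x : ~ range (fun y => t * y)%g x ->
  range_proj W t f x = 0.
Proof. by move=> tx; rewrite /range_proj adjoint_W /= W_fun_out. Qed.

(** Nica-covariance is a statement about the right ideals: [s P] and [t P] are
    disjoint or meet in [m P], with [m] the least common upper bound. *)
Lemma W_nica_covariant : nica_covariant (@W R G P).
Proof.
split.
- split.
  + apply/bopP => f; apply: ell2_ext => x.
    by rewrite -[x in LHS]mul1g -[LHS]/(W_fun _ _ _) W_funM.
  + move=> s t; apply/bopP => f; apply: ell2_ext => x.
    rewrite -[LHS]/(W_fun (s * t)%g f x) -[RHS]/(W_fun s (W_fun t f) x).
    have [[y _ <-]|sx] := pselect (range (fun y => s * y)%g x); last first.
      rewrite !W_fun_out// => -[z _ zx]; apply: sx.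
      by exists (t * z)%g => //; rewrite mulgA.
    rewrite W_funM.
    have [[z _ <-]|ty] := pselect (range (fun y => t * y)%g y); last first.
      rewrite !W_fun_out// => -[z _ zy]; apply: ty; exists z => //.
      by apply: (@semigroup_mul_inj G P s); rewrite mulgA.
    by rewrite mulgA !W_funM.
  + move=> t; apply/bopP => f; rewrite adjoint_W; apply: ell2_ext => x /=.
    by rewrite W_funM.
- move=> s t st; apply/bopP => f; apply: ell2_ext => x; rewrite bop_mulE.
  have [a [b [sa tb]]] := least_common_ub_dvd st.
  have [[y _ <-]|sx] := pselect (range (fun y => s * y)%g x); last first.
    rewrite range_proj_W_out// range_proj_W_out// => -[y _ yx]; apply: sx.
    by exists (a * y)%g => //; rewrite mulgA sa.
  rewrite range_proj_WM.
  have [[z _ zE]|tx] := pselect (range (fun y => t * y)%g (s * y)%g); last first.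
    rewrite range_proj_W_out// range_proj_W_out// => -[z _ zx]; apply: tx.
    by exists (b * z)%g => //; rewrite mulgA tb.
  rewrite -zE range_proj_WM.
  have [c tzE] := least_common_ub_min (esym zE).
  by rewrite zE tzE range_proj_WM.
- move=> s t st; apply/bopP => f; apply: ell2_ext => x; rewrite bop_mulE.
  have [[y _ <-]|sx] := pselect (range (fun y => s * y)%g x); last first.
    by rewrite range_proj_W_out.
  rewrite range_proj_WM range_proj_W_out// => -[z _ zE]; apply: st.
  by apply/common_ubP; exists y, z.
Qed.

End left_regular_representation.

(** * Nica-covariant representations *)

Section nica_covariant_theory.
Context {R : realType} {G : groupType} {P : quasi_lattice G} {H : hilbertType R}.
Context (V : P -> bop H) (nicaV : nica_covariant V).
Implicit Types s t a b u v : P.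

Let isoV := nica_isometric nicaV.
Let VM s t : V (s * t)%g = V s * V t. Proof. exact: isom_repM. Qed.
Let VK t : adjoint (V t) * V t = 1. Proof. exact: isom_rep_isometry. Qed.
Let V_adj t : is_adjoint (V t) (adjoint (V t)).
Proof. exact/isometry_is_adjoint/VK. Qed.

Lemma nica_adjointM s t : adjoint (V (s * t)%g) = adjoint (V t) * adjoint (V s).
Proof. by rewrite VM; apply/is_adjointE/is_adjointM; exact: V_adj. Qed.

Lemma nica_adjoint_rank s t :
  adjoint (V s * adjoint (V t)) = V t * adjoint (V s).
Proof.
apply: is_adjointE; apply: is_adjointM; first exact: V_adj.
exact/is_adjoint_sym/V_adj.
Qed.

Lemma range_proj1 : range_proj V 1%g = 1.
Proof. by rewrite /range_proj isom_rep1// mul1r; apply: is_adjointE. Qed.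

Lemma range_projK t : range_proj V t * V t = V t.
Proof. by rewrite /range_proj -mulrA VK mulr1. Qed.

Lemma range_projKl t : adjoint (V t) * range_proj V t = adjoint (V t).
Proof. by rewrite /range_proj mulrA VK mul1r. Qed.

Lemma range_projM_dvd t a :
  range_proj V (t * a)%g = V t * range_proj V a * adjoint (V t).
Proof. by rewrite /range_proj nica_adjointM VM !mulrA. Qed.

Lemma range_proj_dvd_le t a :
  range_proj V t * range_proj V (t * a)%g = range_proj V (t * a)%g.
Proof. by rewrite range_projM_dvd !mulrA range_projK. Qed.

Lemma range_proj_projection t : projection (range_proj V t).
Proof.
split; last exact: nica_adjoint_rank.
by rewrite {2}/range_proj mulrA range_projK.
Qed.

Lemma range_proj_comm s t : GRing.comm (range_proj V s) (range_proj V t).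
Proof.
have [st|st] := pselect (common_ub s t).
  rewrite /GRing.comm !(nica_meet nicaV)//; first by rewrite least_common_ubC.
  exact: common_ubC.
by rewrite /GRing.comm !(nica_disjoint nicaV)// => /common_ubC.
Qed.

(** The product rule of the inverse semigroup, valid in every Nica-covariant
    representation: insert the range projections of [s] and [t] in the middle,
    replace their product by that of [s a = t b], and cancel isometries. *)
Lemma nica_adjoint_meet s t a b : common_ub s t ->
  (s * a)%g = least_common_ub s t -> (t * b)%g = least_common_ub s t ->
  adjoint (V s) * V t = V a * adjoint (V b).
Proof.
move=> st sa tb.
rewrite -(range_projKl s) -(range_projK t) mulrA -(mulrA _ (range_proj V s)).
rewrite (nica_meet nicaV st) /range_proj -{1}sa -tb nica_adjointM VM.
by rewrite !mulrA VK mul1r -!mulrA VK mulr1.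
Qed.

Lemma nica_adjoint_disjoint s t : ~ common_ub s t -> adjoint (V s) * V t = 0.
Proof.
move=> st; rewrite -(range_projKl s) -(range_projK t) mulrA.
by rewrite -(mulrA _ (range_proj V s)) (nica_disjoint nicaV)// mulr0 mul0r.
Qed.

Lemma nica_partial_isometry s t : partial_isometry (V s * adjoint (V t)).
Proof.
rewrite /partial_isometry nica_adjoint_rank !mulrA.
by rewrite -(mulrA (V s)) VK mulr1 -(mulrA (V s)) VK mulr1.
Qed.

Lemma compl_range_proj_projection_in (A : set (bop H)) (F : seq P) :
  cstar_subalgebra A -> (forall t, A (range_proj V t)) ->
  projections_in A (1 - \prod_(t <- F) (1 - range_proj V t)).
Proof.
move=> Aalg AL; have A1 : A 1 by rewrite -range_proj1.
split.
  apply: cstar_subalgebraB => //; apply: cstar_subalgebra_prod => // t.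
  exact: cstar_subalgebraB.
apply/projection_compl/projection_prod => [t|s t].
  exact/projection_compl/range_proj_projection.
apply: commrB; first exact: commr1.
by apply/commr_sym/commrB; [exact: commr1|exact: range_proj_comm].
Qed.

(** The factor [1 - L(t)] of the product annihilates [L(t)], since all the
    factors commute. *)
Lemma compl_prod_range_proj (F : seq P) t : t \in F ->
  (1 - \prod_(s <- F) (1 - range_proj V s)) * range_proj V t = range_proj V t.
Proof.
move=> tF; rewrite mulrBl mul1r.
suff -> : \prod_(s <- F) (1 - range_proj V s) * range_proj V t = 0.
  by rewrite subr0.
have cm : GRing.comm (\prod_(s <- F) (1 - range_proj V s)) (range_proj V t).
  apply/commr_sym/commr_prod => s _; apply: commrB; first exact: commr1.
  exact: range_proj_comm.
rewrite cm; elim: F tF {cm} => // s F IH; rewrite inE big_cons => /orP[/eqP<-|tF].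
  by rewrite mulrA mulrBr mulr1 (range_proj_projection t).1 subrr mul0r.
rewrite mulrA mulrBr mulr1 range_proj_comm -{1}[range_proj V t]mul1r -mulrBl.
by rewrite -mulrA IH// mulr0.
Qed.

End nica_covariant_theory.

(** * The inverse semigroup of the left regular representation *)

Section nica_semigroup.
Context {R : realType} {G : groupType} {P : quasi_lattice G}.
Implicit Types s t a b u v : P.

Notation L := (range_proj (@W R G P)).

Lemma delta_neq0 s : delta s <> 0 :> ell2 R P.
Proof.
move=> /(congr1 (fun f : ell2 R P => f s)) /=; rewrite eqxx => /eqP.
by rewrite oner_eq0.
Qed.

Lemma W_rank_delta s t a :
  (W s * adjoint (W t)) (delta (t * a)%g) = delta (s * a)%g :> ell2 R P.
Proof.
rewrite -W_delta -[LHS]/((W s * adjoint (W t) * W t) (delta a)).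
rewrite -mulrA (isom_rep_isometry (nica_isometric W_nica_covariant)) mulr1.
exact: W_delta.
Qed.

Lemma W_rank_delta1 s t : (W s * adjoint (W t)) (delta t) = delta s :> ell2 R P.
Proof. by have := W_rank_delta s t 1%g; rewrite !mulg1. Qed.

Lemma W_rank_neq0 s t : W s * adjoint (W t) <> 0 :> bop (ell2 R P).
Proof.
move=> /bopP/(_ (delta t)); rewrite W_rank_delta1; exact: delta_neq0.
Qed.

Lemma range_proj_W_dvd s t : L s (delta t) = delta t :> ell2 R P ->
  exists a, t = (s * a)%g.
Proof.
move=> /(congr1 (fun f : ell2 R P => f t)); have [[a _ <-]|st] :=
  pselect (range (fun y => s * y)%g t); first by exists a.
by rewrite range_proj_W_out//= eqxx => /esym/eqP; rewrite oner_eq0.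
Qed.

Lemma range_proj_W_inj : injective L.
Proof.
have dvd s t : L s = L t -> exists a, t = (s * a)%g.
  move=> st; apply: range_proj_W_dvd; rewrite st; exact: W_rank_delta1.
move=> s t st; have [a tE] := dvd _ _ st; have [b sE] := dvd _ _ (esym st).
exact: dvd_anti sE tE.
Qed.

(** The initial projection is that of [t], hence determines [t]; evaluation at
    the basis vector of [t] then recovers [s]. *)
Lemma W_rank_inj s t s' t' :
  W s * adjoint (W t) = W s' * adjoint (W t') :> bop (ell2 R P) ->
  s = s' /\ t = t'.
Proof.
have nicaW := @W_nica_covariant R G P.
have init u v : L v = adjoint (W u * adjoint (W v)) * (W u * adjoint (W v)).
  rewrite (nica_adjoint_rank nicaW) mulrA -(mulrA (W v)).
  by rewrite (isom_rep_isometry (nica_isometric nicaW)) mulr1.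
move=> E; have tt' : t = t'.
  by apply: range_proj_W_inj; rewrite (init s) E -init.
split=> //; move/bopP/(_ (delta t)): E; rewrite tt' !W_rank_delta1.
move=> /(congr1 (fun f : ell2 R P => f s)) /=; rewrite eqxx.
by case: eqP => // _ /eqP; rewrite oner_eq0.
Qed.

Lemma range_proj_W_common_ub s t : L s * L t <> 0 -> common_ub s t.
Proof.
have [//|st] := pselect (common_ub s t).
by rewrite (nica_disjoint W_nica_covariant).
Qed.

End nica_semigroup.

Section nica_representation.
Context {R : realType} {G : groupType} {P : quasi_lattice G} {H : hilbertType R}.
Context (V : P -> bop H) (nicaV : nica_covariant V).
Implicit Types s t a b u v : P.

(** A relation turned into a function: on nonzero elements of the inverse
    semigroup it is single-valued by [W_rank_inj], and the default value takes
    care of 0. *)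
Definition nica_rep (A : bop (ell2 R P)) : bop H :=
  xget 0 [set B | exists s t, A = W s * adjoint (W t) /\ B = V s * adjoint (V t)].

Lemma nica_repE s t : nica_rep (W s * adjoint (W t)) = V s * adjoint (V t).
Proof.
rewrite /nica_rep; case: xgetP => [_ -> /= [u [v [/W_rank_inj[-> ->]]]]//|no].
by case: (no (V s * adjoint (V t))); exists s, t.
Qed.

Lemma nica_rep0 : nica_rep 0 = 0.
Proof.
by apply: xgetPN => B /= [s [t [/esym/W_rank_neq0]]].
Qed.

Lemma nica_rep_unital : unital_representation (@nica_semigroup R G P) nica_rep.
Proof.
have nicaW := @W_nica_covariant R G P.
split.
- by rewrite -(range_proj1 nicaW) nica_repE -(range_proj1 nicaV).
- exact: nica_rep0.
- move=> A B [->|[s [t ->]]]; first by rewrite !(mul0r, nica_rep0).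
  move=> [->|[u [v ->]]]; first by rewrite !(mulr0, nica_rep0).
  rewrite !nica_repE !mulrA -(mulrA (W s)) -(mulrA (V s)).
  have [tu|tu] := pselect (common_ub t u); last first.
    rewrite (nica_adjoint_disjoint nicaW)// (nica_adjoint_disjoint nicaV)//.
    by rewrite !(mulr0, mul0r) nica_rep0.
  have [a [b [ta ub]]] := least_common_ub_dvd tu.
  rewrite (nica_adjoint_meet nicaW tu ta ub) (nica_adjoint_meet nicaV tu ta ub).
  rewrite !mulrA -!(isom_repM (nica_isometric _))// -!mulrA.
  by rewrite -(nica_adjointM nicaW) -(nica_adjointM nicaV) nica_repE.
- move=> _ [->|[s [t ->]]].
    by rewrite nica_rep0 !(is_adjointE is_adjoint0) nica_rep0.
  by rewrite (nica_adjoint_rank nicaW) !nica_repE (nica_adjoint_rank nicaV).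
- move=> _ [->|[s [t ->]]].
    by rewrite nica_rep0 /partial_isometry !mul0r.
  by rewrite nica_repE; exact: nica_partial_isometry.
Qed.

End nica_representation.

(** * Covers and tightness *)

Section tightness.
Context {R : realType} {G : groupType} {P : quasi_lattice G} {H : hilbertType R}.
Context (V : P -> bop H) (nicaV : nica_covariant V).
Implicit Types s t a b u v : P.

Let LW := range_proj (@W R G P).
Let LV := range_proj V.
Let nicaW := @W_nica_covariant R G P.

Lemma covers_semigroup_cover (F : {fset P}) : covers_semigroup F ->
  is_cover (LW @` [set` F]) (below nica_projections (1 : bop (ell2 R P))).
Proof.
move=> coverF; split=> [_ [t _ <-]|z [[->|[t ->]] _] z0]; [|by []|].
  by split; [right; exists t|exact: mul1r].
have [s sF ts] := coverF t; exists (LW s); first by exists s.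
have /common_ubP[a [b tasb]] := ts => E.
move/bopP/(_ (delta (t * a)%g)): E.
rewrite /LW /range_proj bop_mulE W_rank_delta tasb W_rank_delta.
exact: delta_neq0.
Qed.

Lemma tight_prod0 (F : {fset P}) : tight V -> covers_semigroup F ->
  \prod_(t <- F) (1 - LV t) = 0.
Proof.
move=> [sigma [rep sigmaE tgt]] coverF.
have sigmaL t : sigma (LW t) = LV t := sigmaE t t.
have E1 : nica_projections (1 : bop (ell2 R P)).
  by right; exists 1%g; rewrite -[RHS]/(LW 1%g) /LW range_proj1.
have finZ : finite_set (LW @` [set` F]) by exact/finite_image/finite_fset.
have [_ _ least] := tgt _ _ E1 finZ (covers_semigroup_cover coverF).
have : proj_le (sigma 1) (1 - \prod_(t <- F) (1 - LV t)).
  apply: least.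
    apply: compl_range_proj_projection_in => //.
      exact: cstar_gen_subalgebra.
    by move=> t; apply: sub_cstar_gen; exists (LW t) => //; right; exists t.
  move=> _ [_ [t tF <-] <-]; rewrite sigmaL; exact: compl_prod_range_proj.
rewrite (rep1 rep) /proj_le mulr1 => /eqP.
by rewrite -subr_eq0 addrC addKr oppr_eq0 => /eqP.
Qed.

Lemma mul_prod_compl (T : bop H) (F : seq P) :
  (forall a, a \in F -> T * LV a = 0) -> T * \prod_(a <- F) (1 - LV a) = T.
Proof.
elim: F => [|a F IH] TF; first by rewrite big_nil mulr1.
rewrite big_cons mulrA mulrBr mulr1 TF ?mem_head// subr0.
by apply: IH => b bF; apply: TF; rewrite inE bF orbT.
Qed.

(** Given [x], apply the cover property to the projection of [t x]: some [t a]
    in the cover has a common upper bound with [t x], and [t] cancels. *)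
Lemma cover_quotient_covers t (Z : set (bop (ell2 R P))) (F : {fset P}) :
  is_cover Z (below nica_projections (LW t)) ->
  [set` F] = [set a | Z (LW (t * a)%g)] -> covers_semigroup F.
Proof.
move=> [Zsub Zcov] FE x.
have [||f Zf] := Zcov (LW (t * x)%g).
- by split; [right; exists (t * x)%g|exact: range_proj_dvd_le].
- exact: W_rank_neq0.
have [[->|[r rE]] fle] := Zsub f Zf; first by rewrite mul0r.
rewrite {}rE -[_ * adjoint _]/(LW r) in Zf fle *.
have [a rta] : exists a, r = (t * a)%g.
  apply: (@range_proj_W_dvd R).
  have Lr : LW r (delta r) = delta r by exact: W_rank_delta1.
  by rewrite -[in LHS]Lr -[LHS]/((LW t * LW r) (delta r)) fle.
move=> /range_proj_W_common_ub/common_ubP[c [d]]; rewrite rta -!mulgA.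
move=> /semigroup_mul_inj cd.
exists a; last by apply/common_ubP; exists d, c.
have : [set` F] a by rewrite FE /= -rta.
by [].
Qed.

(** For [q] dominating the image of a cover of the interval below [W(t) W(t)^*],
    it suffices that [q V(t) = V(t)]. *)
Lemma prod0_tight_on :
  (forall F : {fset P}, covers_semigroup F -> \prod_(t <- F) (1 - LV t) = 0) ->
  tight_on nica_projections (nica_rep V).
Proof.
move=> prod0 x Z Ex finZ coverZ.
have Zsub := coverZ.1.
have rep := nica_rep_unital nicaV.
have ES (z : bop (ell2 R P)) : nica_projections z -> nica_semigroup z.
  by move=> [->|[t ->]]; [left|right; exists t, t].
have repL t : nica_rep V (LW t) = LV t by exact: nica_repE.
split.
- split; first by apply: sub_cstar_gen; exists x.
  case: Ex => [->|[t ->]]; first by rewrite nica_rep0; exact: projection0.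
  by rewrite nica_repE; exact: range_proj_projection.
- move=> _ [z /Zsub[Ez zx] <-].
  by rewrite /proj_le -(repM rep) ?zx//; exact: ES.
move=> q _ qub; case: Ex coverZ => [->|[t ->]] coverZ.
  by rewrite nica_rep0 /proj_le mulr0.
rewrite -[W t * _]/(LW t) repL.
have finA : finite_set [set a | Z (LW (t * a)%g)].
  apply: (finite_preimage (f := fun a => LW (t * a)%g)) finZ => a b _ _.
  by move=> /range_proj_W_inj/semigroup_mul_inj.
have coverF : covers_semigroup (fset_set [set a | Z (LW (t * a)%g)]).
  by apply: cover_quotient_covers coverZ _; rewrite fset_setK.
have VK : adjoint (V t) * V t = 1.
  exact: isom_rep_isometry (nica_isometric nicaV) t.
have : (1 - q) * V t * \prod_(a <- fset_set [set a | Z (LW (t * a)%g)])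
    (1 - LV a) = (1 - q) * V t.
  apply: mul_prod_compl => a; rewrite in_fset_set// inE /= => Za.
  have : q * LV (t * a)%g = LV (t * a)%g.
    by rewrite -repL; apply: qub; exists (LW (t * a)%g).
  (* Multiplying by V(t) on the right cancels the last factor of V(t) L(a) V(t)^*. *)
  rewrite /LV range_projM_dvd// => /(congr1 (fun S => S * V t)).
  rewrite -!mulrA VK mulr1 => qE.
  by rewrite mulrBl mul1r qE subrr.
rewrite (prod0 _ coverF) mulr0 mulrBl mul1r => /esym/eqP.
rewrite subr_eq0 => /eqP qV.
by rewrite /proj_le /LV /range_proj mulrA -qV.
Qed.

End tightness.

Theorem proposition7p2 (R : realType) (G : groupType) (P : quasi_lattice G)
    (H : hilbertType R) (V : P -> bop H) (nicaV : nica_covariant V) :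
  tight V <->
  (forall F : {fset P}, covers_semigroup F ->
     \prod_(t <- F) (1 - V t * adjoint (V t)) = 0).
Proof.
split=> [tightV F|prod0]; first exact: tight_prod0.
exists (nica_rep V); split; first exact: nica_rep_unital.
  exact: nica_repE.
exact: prod0_tight_on.
Qed.
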